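(* Let $k\ge 2$ be an integer and let $J_k$ be the $k\times k$ permutation matrix whose $1$ entries are exactly at positions $(i,i+1)$ for $1\le i\le k-1$ and $(k,1)$. Then for all integers $m,n\ge k$, \[sat(J_k,m,n)\ge (k-2)\max(m,n)+m+n-1-\frac{(k-2)(k-1)}{2}.\]
   Context: All matrices are $0$-$1$ matrices; an $m\times n$ matrix has $m$ rows and $n$ columns. The weight of a matrix is its number of $1$ entries. A matrix $M$ contains a $k\times l$ pattern $P$ if there are rows $r_1<\dots<r_k$ and columns $c_1<\dots<c_l$ of $M$ such that $M(r_a,c_b)=1$ whenever $P(a,b)=1$; otherwise $M$ avoids $P$. A matrix $M$ is saturating for $P$ if $M$ avoids $P$ and changing any single $0$ entry of $M$ to $1$ yields a matrix containing $P$. $sat(P,m,n)$ is the minimum weight of an $m\times n$ matrix saturating for $P$. *)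

(* Defs.v *)
From mathcomp Require Import all_boot all_order all_algebra.

Set Implicit Arguments.
Unset Strict Implicit.
Unset Printing Implicit Defensive.

Definition weight (m n : nat) (M : 'M[bool]_(m, n)) : nat :=
  \sum_(i < m) \sum_(j < n) M i j.

Definition increasing (p q : nat) (f : {ffun 'I_p -> 'I_q}) : bool :=
  [forall a : 'I_p, forall b : 'I_p, (a < b) ==> (f a < f b)].

Definition contains (k l m n : nat) (P : 'M[bool]_(k, l))
    (M : 'M[bool]_(m, n)) : bool :=
  [exists r : {ffun 'I_k -> 'I_m}, exists c : {ffun 'I_l -> 'I_n},
    [&& increasing r, increasing c &
        [forall a, forall b, P a b ==> M (r a) (c b)]]].

Definition set_one (m n : nat) (M : 'M[bool]_(m, n)) (i : 'I_m) (j : 'I_n) :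
    'M[bool]_(m, n) :=
  \matrix_(a, b) (M a b || (a == i) && (b == j)).

Definition saturating (k l m n : nat) (P : 'M[bool]_(k, l))
    (M : 'M[bool]_(m, n)) : bool :=
  ~~ contains P M &&
  [forall i, forall j, ~~ M i j ==> contains P (set_one M i j)].

(* The default value m * n bounds every weight, so it never lowers the minimum;
   it is a junk value only when no saturating matrix exists, which satP below
   rules out for every pattern that has a 1 entry. *)
Definition sat (k l : nat) (P : 'M[bool]_(k, l)) (m n : nat) : nat :=
  \big[minn/m * n]_(M : 'M[bool]_(m, n) | saturating P M) weight M.

(* Indices start at 0: the 1 entries are (i, i + 1) for i < k - 1, and
   (k - 1, 0). *)
Definition J (k : nat) : 'M[bool]_(k, k) :=
  \matrix_(i, j) ((j == i.+1 :> nat) || (i.+1 == k :> nat) && (j == 0 :> nat)).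

Lemma weight_le (m n : nat) (M : 'M[bool]_(m, n)) : weight M <= m * n.
Proof.
have -> : m * n = \sum_(i < m) \sum_(j < n) 1.
  by under eq_bigr do rewrite sum1_card card_ord; rewrite sum_nat_const card_ord.
by apply: leq_sum => i _; apply: leq_sum => j _; case: (M i j).
Qed.

Lemma sat_le (k l m n : nat) (P : 'M[bool]_(k, l)) (M : 'M[bool]_(m, n)) :
  saturating P M -> sat P m n <= weight M.
Proof.
move=> sM; rewrite /sat; have := mem_index_enum M.
elim: (index_enum _) => //= N s IHs; rewrite inE big_cons => /predU1P[<-|/IHs le].
  by rewrite sM geq_minl.
by case: ifP => // _; rewrite geq_min le orbT.
Qed.

Lemma sat_attained (k l m n : nat) (P : 'M[bool]_(k, l)) :
  (exists M : 'M[bool]_(m, n), saturating P M) ->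
  exists2 M : 'M[bool]_(m, n), saturating P M & weight M = sat P m n.
Proof.
case=> M0 sM0; case: (arg_minnP (@weight m n) sM0) => M sM minM.
exists M => //; apply/eqP; rewrite eqn_leq sat_le // andbT /sat.
elim/big_ind: _ => [|x y hx hy|N sN]; first exact: weight_le.
- by rewrite leq_min hx hy.
- exact: minM.
Qed.

Lemma saturating_exists (k l m n : nat) (P : 'M[bool]_(k, l)) a b :
  P a b -> exists M : 'M[bool]_(m, n), saturating P M.
Proof.
move=> Pab; pose avoids := [pred M : 'M[bool]_(m, n) | ~~ contains P M].
have avoid0 : avoids (const_mx false).
  apply/negP => /existsP[r /existsP[c /and3P[_ _ /forallP/(_ a)/forallP/(_ b)]]].
  by rewrite Pab mxE.
case: (arg_maxnP (@weight m n) avoid0) => M aM maxM.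
exists M; apply/andP; split=> //; apply/forallP=> i; apply/forallP=> j.
apply/implyP=> Mij; apply: contraT => /maxM; rewrite /= leqNgt => /negP[].
rewrite /weight (bigD1 i) //= [X in _ < X](bigD1 i) //= -addSn leq_add //.
  rewrite (bigD1 j) //= [X in _ < X](bigD1 j) //= -addSn leq_add //.
    by rewrite !mxE !eqxx orbT (negPf Mij).
  by apply: leq_sum => b' _; rewrite mxE; case: (M i b').
apply: leq_sum => a' _; apply: leq_sum => b' _.
by rewrite mxE; case: (M a' b').
Qed.

Lemma satP (k l m n : nat) (P : 'M[bool]_(k, l)) a b : P a b ->
  (exists2 M : 'M[bool]_(m, n), saturating P M & weight M = sat P m n) /\
  (forall M : 'M[bool]_(m, n), saturating P M -> sat P m n <= weight M).
Proof.
move=> Pab; split; last by move=> M; apply: sat_le.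
exact: sat_attained (saturating_exists _ _ Pab).
Qed.

(* Main.v *)
Require Import Defs.
From mathcomp Require Import all_boot all_order all_algebra.
From mathcomp Require Import zify lra.

(** A matrix contains [J k] iff some 1 entry has a chain of [k - 1] ones, going
strictly down and right, in the open quadrant above and to the right of it.
Let [M] be saturating and let [U] be the set of positions whose quadrant has
no such chain. All ones lie in [U], and the staircase of [m + n - 1] positions
bounding [U] from below and left consists of ones: a zero of [U] needs a 1
strictly below and left of it to complete a pattern.

In each column [j] except the first one there are [k - 2] further ones above
the staircase. Let [(p, c0)] be the leftmost staircase entry in the row where
column [j] meets the staircase. For [i < p], let [f i] be the length of the
longest chain above row [i] with columns strictly between [c0] and [j], and
[g i] that of the longest chain with rows strictly between [i] and [p] and
columns right of [j]. If [(i, j)] is a zero, a pattern completed by it has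
its corner at or above and left of [(p, c0)], and exchanging tails of crossing
chains shows that [f] and [g] do not change at row [i]. Hence column [j] has
at least [f i] ones above row [i] and at least [g i] ones in the rows between
[i] and [p], and some row has [f i + g i >= k - 2].

Thus the weight is at least [(k - 2)(n - 1) + m + n - 1]. Reflection in the
antidiagonal fixes [J k] and exchanges [m] and [n]. *)

(** * Chains of ones: cutting, joining and exchanging tails *)

Definition step (r c : nat -> nat) (a : nat) : Prop :=
  r a < r a.+1 /\ c a < c a.+1.

(* [t] ones forming a chain in the rows [r1 .. r2 - 1] and the columns
   [c1 .. c2 - 1]; the values of [r] and [c] beyond [t] are junk. *)
Definition chain (A : nat -> nat -> bool) (r1 r2 c1 c2 t : nat) : Prop :=
  exists r c : nat -> nat, (forall a, a.+1 < t -> step r c a) /\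
    (forall a, a < t -> [/\ A (r a) (c a), r1 <= r a < r2 & c1 <= c a < c2]).

Section Chains.

Variable A : nat -> nat -> bool.

Lemma step_lt (r c : nat -> nat) t : (forall a, a.+1 < t -> step r c a) ->
  forall a b, a < b < t -> r a < r b /\ c a < c b.
Proof.
move=> H a; elim=> [|b IH] //; rewrite ltnS => /andP[ab bt].
have [sr sc] := H b bt; move: ab; rewrite leq_eqVlt => /predU1P[->//|ab].
have [] : r a < r b /\ c a < c b by apply: IH; rewrite ab ltnW.
by lia.
Qed.

Lemma chain0 r1 r2 c1 c2 : chain A r1 r2 c1 c2 0.
Proof. by exists id, id; split. Qed.

Lemma chain_sub r1 r2 c1 c2 t r1' r2' c1' c2' t' :
  r1' <= r1 -> r2 <= r2' -> c1' <= c1 -> c2 <= c2' -> t' <= t ->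
  chain A r1 r2 c1 c2 t -> chain A r1' r2' c1' c2' t'.
Proof.
move=> ? ? ? ? ? [r [c [S I]]]; exists r, c; split=> a ha; first by apply: S; lia.
have [|? ? ?] := I a; first lia.
by split=> //; lia.
Qed.

(** The first [p] entries of one chain are followed by [e] entries of another, read from index [q];
    only the junction has to be compared. *)
Lemma chain_glue r1 r2 c1 c2 (r c r' c' : nat -> nat) p q e :
  (forall a, a.+1 < p -> step r c a) ->
  (forall a, a.+1 < e -> step r' c' (q + a)) ->
  (0 < p -> 0 < e -> r p.-1 < r' q /\ c p.-1 < c' q) ->
  (forall a, a < p -> [/\ A (r a) (c a), r1 <= r a < r2 & c1 <= c a < c2]) ->
  (forall a, a < e -> [/\ A (r' (q + a)) (c' (q + a)),
     r1 <= r' (q + a) < r2 & c1 <= c' (q + a) < c2]) ->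
  chain A r1 r2 c1 c2 (p + e).
Proof.
move=> S S' L I I'.
exists (fun a => if a < p then r a else r' (q + (a - p))),
  (fun a => if a < p then c a else c' (q + (a - p))); split=> a ha.
- rewrite /step; case: (ltngtP a.+1 p) => hp.
  + exact: S.
  + have -> : a.+1 - p = (a - p).+1 by lia.
    by rewrite addnS; apply: S'; lia.
  + by rewrite hp subnn addn0 (_ : a = p.-1); [apply: L; lia|lia].
- by case: ltnP => hp; [apply: I|apply: I'; lia].
Qed.

Lemma chain_cat r1 rm r2 c1 cm cm' c2 s t :
  r1 <= rm <= r2 -> c1 <= cm -> cm <= cm' <= c2 ->
  chain A r1 rm c1 cm s -> chain A rm r2 cm' c2 t ->
  chain A r1 r2 c1 c2 (s + t).
Proof.
move=> h1 h2 h3 [r [c [S I]]] [r' [c' [S' I']]].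
apply: (@chain_glue _ _ _ _ r c r' c' s 0 t) => //.
- move=> s0 t0; have [|_ ? ?] := I s.-1; first lia.
  by have [|_ ? ?] := I' 0; lia.
- by move=> a ha; have [? ? ?] := I a ha; split=> //; lia.
- by move=> a ha; have [? ? ?] := I' a ha; rewrite add0n; split=> //; lia.
Qed.

Lemma chain1 i j : A i j -> chain A i i.+1 j j.+1 1.
Proof. by exists (fun=> i), (fun=> j); split=> // a _; split; rewrite ?leqnn. Qed.

Lemma chain_rows r1 r2 c1 c2 t : chain A r1 r2 c1 c2 t -> t <= r2 - r1.
Proof.
case=> r [c [S I]]; suff H a : a < t -> r1 + a <= r a.
  by case: t S I H => // t S I H; have := H t (ltnSn _); have [] := I t (ltnSn _); lia.
elim: a => [|a IH] ha; first by have [] := I 0 ha; lia.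
by have [] := S a ha; have := IH (ltnW ha); lia.
Qed.

Lemma chain_cols r1 r2 c1 c2 t : chain A r1 r2 c1 c2 t -> t <= c2 - c1.
Proof.
case=> r [c [S I]]; suff H a : a < t -> c1 + a <= c a.
  by case: t S I H => // t S I H; have := H t (ltnSn _); have [] := I t (ltnSn _); lia.
elim: a => [|a IH] ha; first by have [] := I 0 ha; lia.
by have [] := S a ha; have := IH (ltnW ha); lia.
Qed.

Lemma chain_behead r1 r2 c1 c2 t :
  chain A r1 r2 c1 c2 t.+1 -> chain A r1 r2 c1.+1 c2 t.
Proof.
case=> r [c [S I]]; exists (r \o succn), (c \o succn); split=> a ha /=.
  exact: S.
have [? ? ?] := I a.+1 ha; split=> //.
have [|_ ?] := @step_lt r c t.+1 S 0 a.+1; first lia.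
have [] := I 0 isT; lia.
Qed.

(** Entry [s] is exempt from being a one, so that the chain may pass through a zero that is being
    changed to 1. *)
Lemma chain_split i j r1 r2 c1 c2 s t (r c : nat -> nat) :
  (forall a, a.+1 < t -> step r c a) ->
  (forall a, a < t -> a != s ->
     [/\ A (r a) (c a), r1 <= r a < r2 & c1 <= c a < c2]) ->
  s < t -> r s = i -> c s = j ->
  chain A r1 i c1 j s /\ chain A i.+1 r2 j.+1 c2 (t - s.+1).
Proof.
move=> S I st ri cj; split.
- exists r, c; split=> a ha; first by apply: S; lia.
  have [||? ? ?] := I a; try lia.
  have [|? ?] := @step_lt r c t S a s; first lia.
  by split=> //; lia.
- exists (fun a => r (s.+1 + a)), (fun a => c (s.+1 + a)); split=> a ha.
    by rewrite /step !addnS; apply: S; lia.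
  have [||? ? ?] := I (s.+1 + a); try lia.
  have [|? ?] := @step_lt r c t S s (s.+1 + a); first lia.
  by split=> //; lia.
Qed.

(** Here [s] counts the entries left of column [j]. Either the next entry lies in column [j], or its
    row ([r2] if there is none) separates the two pieces. *)
Lemma chain_column r1 r2 c1 c2 j t : c1 <= j < c2 -> r1 <= r2 ->
  chain A r1 r2 c1 c2 t ->
  exists s i, r1 <= i <= r2 /\ s <= t /\
   ((chain A r1 i c1 j s /\ chain A i r2 j.+1 c2 (t - s)) \/
    [/\ i < r2, A i j, s < t, chain A r1 i c1 j s &
        chain A i.+1 r2 j.+1 c2 (t - s.+1)]).
Proof.
move=> hj hr [r [c [S I]]].
pose P a := (t <= a) || (j <= c a).
have exP : exists a, P a by exists t; rewrite /P leqnn.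
case: (ex_minnP exP) => s Ps mins.
have lo a : a < s -> a < t /\ c a < j.
  by move=> h; have := mins a; rewrite /P; lia.
have st : s <= t by apply: mins; rewrite /P leqnn.
have left b : (forall a, a < s -> r a < b) -> chain A r1 b c1 j s.
  move=> hb; exists r, c; split=> a ha; first by apply: S; lia.
  by have [? ?] := lo a ha; have [//|? ? ?] := I a; split=> //; have := hb a ha; lia.
have [est|nst] := eqVneq s t.
  exists s, r2; split; first lia; split=> //; left; split.
    by apply: left => a ha; have [|] := I a; lia.
  by rewrite est subnn; apply: chain0.
have lst : s < t by lia.
have cs : j <= c s by move: Ps; rewrite /P; lia.
have [As ? ?] := I s lst.
exists s, (r s); split; first lia; split=> //.
have [ejs|njs] := eqVneq (c s) j.
  right; have [|//|//|//|H1 H2] := @chain_split (r s) j r1 r2 c1 c2 s t r c S.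
    by move=> a ha _; apply: I.
  by split=> //; [lia|rewrite -ejs].
left; split.
  by apply: left => a ha; have [|] := @step_lt r c t S a s; lia.
exists (fun a => r (s + a)), (fun a => c (s + a)); split=> a ha.
  by rewrite /step !addnS; apply: S; lia.
have [|? ? ?] := I (s + a); first lia.
have [->|a0] := posnP a; first by rewrite addn0; split=> //; lia.
have [|? ?] := @step_lt r c t S s (s + a); first lia.
by split=> //; lia.
Qed.

(* If the chains [y] (length [s]) and [w] (length [t]) are aligned at their ends,
   then at the first index where [y] is above [w] either [y] can continue with
   the tail of [w], or [w] with the tail of [y]. *)
Lemma chain_cross_left i j c c0 s t : c <= c0 ->
  chain A 0 i c j s -> chain A 0 i.+1 c0 j t ->
  chain A 0 i c0 j t \/ chain A 0 i.+1 c j s.+1.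
Proof.
move=> cc0 cy cw.
have [st|ts] := ltnP s t.
  by right; apply: chain_sub cw.
case: t cw ts => [|t] cw ts; first by left; apply: chain0.
case: cy cw => ry [cy [Sy Iy]] [rw [cw [Sw Iw]]].
(* Entry [l] of [w] is compared with entry [d + l] of [y], which aligns the ends. *)
pose d := s - t.+1.
have [wi|wi] := ltnP (rw t) i.
  left; exists rw, cw; split=> // a ha; have [? ? ?] := Iw a ha; split=> //.
  have [->//|?] := eqVneq a t.
  by have [|] := @step_lt rw cw t.+1 Sw a t; lia.
pose P l := (l <= t) && (ry (d + l) < rw l).
have exP : exists l, P l.
  by exists t; rewrite /P leqnn /=; have [|] := Iy (d + t); lia.
case: (ex_minnP exP) => l /andP[lt rl] minl.
have [cl|cl] := ltnP (cy (d + l)) (cw l).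
- right; have -> : s.+1 = (d + l).+1 + (t.+1 - l) by lia.
  apply: (@chain_glue _ _ _ _ ry cy rw cw _ l).
  + by move=> a ha; apply: Sy; lia.
  + by move=> a ha; apply: Sw; lia.
  + by [].
  + by move=> a ha; have [|? ? ?] := Iy a; [lia|split=> //; lia].
  + by move=> a ha; have [|? ? ?] := Iw (l + a); [lia|split=> //; lia].
- left; have -> : t.+1 = l + (t.+1 - l) by lia.
  have [? ? ?] := Iw l lt.
  have link : 0 < l -> rw l.-1 < ry (d + l) /\ cw l.-1 < cy (d + l).
    move=> l0; have := minl l.-1; rewrite /P.
    have [|] := @step_lt rw cw t.+1 Sw l.-1 l; first lia.
    by have [|] := @step_lt ry cy s Sy (d + l.-1) (d + l); lia.
  apply: (@chain_glue _ _ _ _ rw cw ry cy _ (d + l)).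
  + by move=> a ha; apply: Sw; lia.
  + by move=> a ha; apply: Sy; lia.
  + by move=> l0 _; apply: link.
  + move=> a ha; have [|? ? ?] := Iw a; first lia.
    have [? ?] := link (leq_trans (ltn0Sn _) ha).
    have [|? ?] := Iy (d + l); first lia.
    split=> //; have [->|?] := eqVneq a l.-1; first lia.
    by have [|] := @step_lt rw cw t.+1 Sw a l.-1; lia.
  + move=> a ha; have [|? HR HC] := Iy (d + l + a); first lia.
    split=> //; move: HR HC; have [->|a0] := posnP a; first by rewrite addn0; lia.
    by have [|] := @step_lt ry cy s Sy (d + l) (d + l + a); lia.
Qed.

(* The same exchange with the chains aligned at their beginnings. *)
Lemma chain_cross_right i r p c n s t : i < r <= p ->
  chain A i.+1 r c n s -> chain A i p c n t ->
  chain A i.+1 p c n t \/ chain A i r c n s.+1.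
Proof.
move=> /andP[ir rp] cx cw.
have [ts|st] := leqP t s.
  by left; apply: chain_sub cx.
case: cx cw => rx [cx [Sx Ix]] [rw [cw [Sw Iw]]].
have [wi|wi] := ltnP i (rw 0).
  left; exists rw, cw; split=> // a ha; have [? ? ?] := Iw a ha; split=> //.
  have [->|?] := posnP a; first by have [|] := Iw 0; lia.
  by have [|] := @step_lt rw cw t Sw 0 a; lia.
pose P l := (s <= l) || (cw l < cx l).
have exP : exists l, P l by exists s; rewrite /P leqnn.
case: (ex_minnP exP) => l Pl minl.
have ls : l <= s by apply: minl; rewrite /P leqnn.
have [Al ? ?] := Iw l (leq_ltn_trans ls st).
(* Here [l] is the first index where [w] is left of [x], or [s]. If [w] is also above [x] there, [w]
   up to [l] precedes the tail of [x]; otherwise [x] before [l] precedes the tail of [w]. *)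
have [good|bad] := boolP ((rw l < r) && ((l < s) ==> (rw l < rx l))).
- right; have -> : s.+1 = l.+1 + (s - l) by lia.
  apply: (@chain_glue _ _ _ _ rw cw rx cx _ l).
  + by move=> a ha; apply: Sw; lia.
  + by move=> a ha; apply: Sx; lia.
  + by move=> _ ? /=; move: Pl; rewrite /P; lia.
  + move=> a ha; have [|? ? ?] := Iw a; first lia.
    split=> //; have [->|?] := eqVneq a l; first lia.
    by have [|] := @step_lt rw cw t Sw a l; lia.
  + by move=> a ha; have [|? ? ?] := Ix (l + a); [lia|split=> //; lia].
- left; have l0 : 0 < l.
    case: posnP => // l0; subst l; case/negP: bad; apply/andP; split; first lia.
    by apply/implyP => s0; have [] := Ix 0 s0; lia.
  have link : rx l.-1 < rw l /\ cx l.-1 < cw l.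
    have [|] := @step_lt rw cw t Sw l.-1 l; first lia.
    have := minl l.-1; rewrite /P => mm.
    have [|_ ? _] := Ix l.-1; first lia.
    have [ls'|] := ltnP l s; last by lia.
    have [|] := @step_lt rx cx s Sx l.-1 l; first lia.
    by have [|] := Ix l; lia.
  have -> : t = l + (t - l) by lia.
  apply: (@chain_glue _ _ _ _ rx cx rw cw _ l).
  + by move=> a ha; apply: Sx; lia.
  + by move=> a ha; apply: Sw; lia.
  + by [].
  + by move=> a ha; have [|? ? ?] := Ix a; [lia|split=> //; lia].
  + move=> a ha; have [|? HR HC] := Iw (l + a); first lia.
    split=> //; have [|? ?] := Ix l.-1; first lia.
    move: HR HC; have [->|a0] := posnP a; first by rewrite addn0; lia.
    by have [|] := @step_lt rw cw t Sw l (l + a); lia.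
Qed.

(** Boolean form of [chain], peeling off the last entry; a search over rows needs it. *)
Fixpoint chainb r1 c1 r2 c2 t : bool :=
  if t is t'.+1 then
    [exists i : 'I_r2, exists j : 'I_c2,
      [&& r1 <= i, c1 <= j, A i j & chainb r1 c1 i j t']]
  else true.

Lemma chainP r1 r2 c1 c2 t :
  reflect (chain A r1 r2 c1 c2 t) (chainb r1 c1 r2 c2 t).
Proof.
elim: t r2 c2 => [|t IH] r2 c2 /=; first by apply: ReflectT; apply: chain0.
apply: (iffP existsP) => [[i /existsP[j /and4P[ri cj Aij /IH ch]]]|].
  have hi := ltn_ord i; have hj := ltn_ord j; rewrite -addn1.
  apply: (@chain_cat r1 i r2 c1 j j c2 t 1 _ _ _ ch); try lia.
  by apply: chain_sub (chain1 _ _ Aij).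
case=> r [c [S I]]; have [At /andP[rl rt] /andP[cl ct]] := I t (ltnSn _).
exists (Ordinal rt); apply/existsP; exists (Ordinal ct).
apply/and4P; split=> //=; apply/IH.
have [|//|//|//|] := @chain_split (r t) (c t) r1 r2 c1 c2 t t.+1 r c S.
- by move=> a ha _; apply: I.
- by [].
Qed.

End Chains.

(** * The staircase of a saturating array *)

Section Saturated.

Variables (A : nat -> nat -> bool) (K m n : nat).

(* With [K = k - 2], [avoiding] and [completing] express that the [m] by [n]
   matrix [A] is saturating for [J k]. *)
Definition avoiding : Prop :=
  forall r c, r < m -> c < n -> A r c -> ~ chain A 0 r c.+1 n K.+1.

Definition completing : Prop :=
  forall i j, i < m -> j < n -> ~~ A i j ->
  chain A 0 i j.+1 n K.+1 \/
  exists r c s, [/\ i < r < m, c < j, A r c, s <= K &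
    chain A 0 i c.+1 j s /\ chain A i.+1 r j.+1 n (K - s)].

Hypotheses (avA : avoiding) (coA : completing) (Km : K.+1 < m) (n0 : 0 < n).

(* The number of rows of column [j] that belong to [U]. *)
Definition height j := find (fun i => chainb A 0 j.+1 i n K.+1) (iota 0 m).

Lemma height_le j : height j <= m.
Proof. by rewrite -[leqRHS](size_iota 0 m) find_size. Qed.

Lemma height_chain i j : height j <= i < m -> chain A 0 i j.+1 n K.+1.
Proof.
move=> /andP[hi im]; set P := fun i => chainb A 0 j.+1 i n K.+1.
have hasP : has P (iota 0 m) by rewrite has_find size_iota; exact: leq_ltn_trans im.
have := nth_find 0 hasP; rewrite -/(height j) nth_iota; last exact: leq_ltn_trans im.
by move/chainP; apply: chain_sub.
Qed.

Lemma height_nchain i j : i < height j -> ~ chain A 0 i j.+1 n K.+1.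
Proof.
move=> hi; have im := leq_trans hi (height_le j).
by have := before_find 0 hi; rewrite nth_iota // => /chainP.
Qed.

Lemma height_mono j j' : j <= j' -> height j <= height j'.
Proof.
move=> jj; rewrite leqNgt; apply/negP => hj.
apply: (height_nchain _ _ hj).
have := @height_chain (height j') j'; rewrite leqnn (leq_trans hj (height_le j)).
by move/(_ isT); apply: chain_sub.
Qed.

Lemma height_ge j : K < height j.
Proof.
rewrite ltnNge; apply/negP => hj.
have /chain_rows : chain A 0 (height j) j.+1 n K.+1 by apply: height_chain; lia.
by lia.
Qed.

Lemma height_last : height n.-1 = m.
Proof.
apply/eqP; rewrite eqn_leq height_le leqNgt; apply/negP => hj.
have /chain_cols : chain A 0 (height n.-1) n.-1.+1 n K.+1.
  by apply: height_chain; lia.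
by lia.
Qed.

Lemma one_height r c : r < m -> c < n -> A r c -> r < height c.
Proof.
move=> rm cn Arc; rewrite ltnNge; apply/negP => h.
by apply: (avA _ _ rm cn Arc); apply: height_chain; rewrite h.
Qed.

(** The staircase occupies rows [height j.-1 - 1] to [height j - 1] of column [j], and all rows
    below index [height 0] of column 0. The corner of a pattern completed at such a zero would lie
    outside its own column's height. *)
Lemma staircase_one i j : j < n -> i < height j ->
  (0 < j -> height j.-1 <= i.+1) -> A i j.
Proof.
move=> jn ij hj; apply: contraT => Aij.
have im := leq_trans ij (height_le j).
have [/(height_nchain _ _ ij)//|[r [c [s [/andP[ir rm] cj Arc _ _]]]]] := coA _ _ im jn Aij.
have := one_height _ _ rm (ltn_trans cj jn) Arc.
have := @height_mono c j.-1; lia.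
Qed.

Definition above i j := \sum_(0 <= a < i) A a j.

Lemma aboveS i j : above i.+1 j = above i j + A i j.
Proof. by rewrite /above big_nat_recr. Qed.

Lemma above_le i i' j : i <= i' -> above i j <= above i' j.
Proof.
move=> ii; rewrite /above [X in _ <= X](big_cat_nat _ ii) //=; exact: leq_addr.
Qed.

(** * Ones of a single column above the staircase *)

Section Column.

Variables j c0 : nat.
Hypotheses (jn : j < n) (c0j : c0 < j)
  (hc0 : height c0 = height j.-1) (minc0 : 0 < c0 -> height c0.-1 < height c0).

Let p := (height j.-1).-1.

Lemma corner_one : A p c0.
Proof.
apply: staircase_one; first lia; rewrite /p ?hc0.
  by have := height_ge j.-1; lia.
by move=> h; have := minc0 h; rewrite hc0; lia.
Qed.

Lemma corner_lt : p < m.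
Proof. by rewrite /p; have := height_ge j.-1; have := height_le j.-1; lia. Qed.

Lemma zero_witness i : i < p -> ~~ A i j ->
  exists r c s, [/\ i < r <= p, c <= c0, A r c, s <= K &
    chain A 0 i c.+1 j s /\ chain A i.+1 r j.+1 n (K - s)].
Proof.
move=> ip Aij; have pm := corner_lt.
have hij : i < height j by have := @height_mono j.-1 j; rewrite /p in ip; lia.
have im := ltn_trans ip pm.
have [/(height_nchain _ _ hij)//|] := coA i j im jn Aij.
case=> r [c [s [/andP[ir rm] cj Arc sK [ch1 ch2]]]].
have rp : r <= p.
  have := one_height _ _ rm (ltn_trans cj jn) Arc.
  by have := @height_mono c j.-1; rewrite /p; lia.
have [cc0|c0c] := leqP c c0; first by exists r, c, s; split=> //; lia.
(* A corner right of column [c0] can be moved to the one at [(p, c0)], weakly below and to the left,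
   so both chains still fit. *)
exists p, c0, s; split=> //; [lia|exact: corner_one|split].
  by apply: chain_sub ch1 => //; lia.
by apply: chain_sub ch2.
Qed.

(** If the exchange instead lengthened the left chain of the witness, its two chains would join to
    [K.+1] ones above and right of the one [(r, c)]. *)
Lemma zero_left i t : i < p -> ~~ A i j ->
  chain A 0 i.+1 c0.+1 j t -> chain A 0 i c0.+1 j t.
Proof.
move=> ip Aij cw; have pm := corner_lt.
have [r [c [s [/andP[ir rp] cc0 Arc sK [ch1 ch2]]]]] := zero_witness _ ip Aij.
have [//|ch] := @chain_cross_left A i j c.+1 c0.+1 s t cc0 ch1 cw.
case: (avA r c _ _ Arc); try lia.
have -> : K.+1 = s.+1 + (K - s) by lia.
by apply: (chain_cat _ _ _ _ _ _ _ _ _ _ _ _ _ ch ch2); lia.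
Qed.

Lemma zero_right i t : i < p -> ~~ A i j ->
  chain A i p j.+1 n t -> chain A i.+1 p j.+1 n t.
Proof.
move=> ip Aij cw; have pm := corner_lt.
have [r [c [s [irp cc0 Arc sK [ch1 ch2]]]]] := zero_witness _ ip Aij.
have [//|ch] := @chain_cross_right A i r p j.+1 n (K - s) t irp ch2 cw.
case: (avA r c _ _ Arc); try lia.
have -> : K.+1 = s + (K - s).+1 by lia.
by apply: (chain_cat _ _ _ _ _ _ _ _ _ _ _ _ _ ch1 ch); lia.
Qed.

(** Moving the lower boundary up by one row costs the chain nothing at a zero of column [j] and at
    most its last entry at a one. *)
Lemma above_left i t : i <= p -> chain A 0 i c0.+1 j t -> t <= above i j.
Proof.
elim: i t => [|i IH] t ip ch; first by have := chain_rows _ _ _ _ _ _ ch; lia.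
rewrite aboveS; have [Aij|Aij] := boolP (A i j); last first.
  by rewrite addn0; apply: IH (ltnW ip) (zero_left _ _ ip Aij ch).
rewrite addn1; case: t ch => // t [r [c [S I]]]; apply: IH (ltnW ip) _.
exists r, c; split=> a ha; first by apply: S; lia.
have [|? ? ?] := I a; first lia.
have [] := I t (ltnSn _); have [|] := @step_lt r c t.+1 S a t; first lia.
by split=> //; lia.
Qed.

(** Mirror argument, by induction on [p - i]: the chain loses its first entry only at a one of
    column [j]. *)
Lemma above_right i t : i <= p -> chain A i p j.+1 n t ->
  t + above i j <= above p j.
Proof.
move=> ip; have -> : i = p - (p - i) by lia.
have : p - i <= p by lia.
elim: (p - i) t => [|d IH] t dp ch.
  by move: ch; rewrite subn0 => /chain_rows; lia.
set i' := p - d.+1 in ch *; have i'p : i' < p by rewrite /i'; lia.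
have ei : p - d = i'.+1 by rewrite /i'; lia.
move: IH; rewrite ei aboveS => IH.
have [Aij|Aij] := boolP (A i' j); last first.
  by have := IH t (ltnW dp) (zero_right _ _ i'p Aij ch); rewrite (negPf Aij) addn0.
move: IH; rewrite Aij => IH.
case: t ch => [|t] ch; first by have := IH 0 (ltnW dp) (chain0 _ _ _ _ _); lia.
suff /(IH t (ltnW dp)) : chain A i'.+1 p j.+1 n t by lia.
case: ch => r [c [S I]]; exists (r \o succn), (c \o succn).
split=> a ha /=; first exact: S.
have [? ? ?] := I a.+1 ha; split=> //.
have [|] := @step_lt r c t.+1 S 0 a.+1; first lia.
by have [] := I 0 isT; lia.
Qed.

Lemma column_above : K <= above p j.
Proof.
have pm := corner_lt; have Kp : K <= p by rewrite /p; have := height_ge j.-1; lia.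
(* With [c0 = 0] no column further left supplies a chain. Either the rows above [p], at least [K]
   many, are all ones, or the witness of a zero has its corner in column 0 and provides chains of
   lengths [s] and [K - s]. *)
have [c00|c00] := posnP c0.
  have [/existsP[i Aij]|] := boolP [exists i : 'I_p, ~~ A i j]; last first.
    rewrite negb_exists => /forallP H; apply: leq_trans Kp _.
    rewrite /above big_mkord (eq_bigr (fun=> 1)); last by move=> i _; rewrite (negPn (H i)).
    by rewrite sum1_card card_ord.
  have [r [c [s [irp cc0 Arc sK [ch1 ch2]]]]] := zero_witness _ (ltn_ord i) Aij.
  have h1 : s <= above i j.
    by apply: above_left; [exact: ltnW|apply: chain_sub ch1 => //; lia].
  have h2 : K - s + above i.+1 j <= above p j.
    by apply: above_right => //; apply: chain_sub ch2 => //; lia.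
  by have := above_le i i.+1 j (leqnSn _); lia.
(* Column [c0.-1] is lower, so [K.+1] chained ones lie above row [p] and right of it; dropping the
   first leaves [K] ones right of [c0], to be cut at column [j]. *)
have ch : chain A 0 p c0.+1 n K.
  apply: chain_behead; rewrite -[c0 in chain _ _ _ c0 _ _](prednK c00).
  by apply: height_chain; have := minc0 c00; rewrite hc0 /p; lia.
have [||s [i [hi [sK H]]]] := @chain_column A 0 p c0.+1 n j K _ _ ch; try lia.
case: H => [[ch1 ch2]|[ip Aij sK' ch1 ch2]].
  have := above_left i s _ ch1; have := above_right i (K - s) _ ch2; lia.
have := above_left i s (ltnW ip) ch1; have := above_right i.+1 _ ip ch2.
by rewrite aboveS Aij; lia.
Qed.

End Column.

(** The [K] ones above row [height j.-1 - 1] are disjoint from the staircase ones, which fill the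
    rows from there to [height j - 1]. *)
Lemma column_weight j : 0 < j < n ->
  K + height j + 1 <= height j.-1 + above m j.
Proof.
move=> /andP[j0 jn].
have exc : exists c, height c == height j.-1 by exists j.-1.
case: (ex_minnP exc) => c0 /eqP hc0 minc0.
have c0j : c0 < j by have := minc0 j.-1 (eqxx _); lia.
have Kab : K <= above (height j.-1).-1 j.
  apply: (@column_above j c0) => // c00; rewrite ltn_neqAle.
  rewrite height_mono ?leq_pred // andbT; apply/negP => /eqP e.
  by have := minc0 c0.-1; rewrite e hc0 eqxx => /(_ isT); lia.
have hjj := @height_mono j.-1 j (leq_pred _).
have := height_ge j.-1 => hg.
suff H d : (height j.-1).-1 + d <= height j ->
    above (height j.-1).-1 j + d <= above ((height j.-1).-1 + d) j.
  have := H (height j - (height j.-1).-1); have := above_le _ _ j (height_le j).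
  by rewrite subnKC; lia.
elim: d => [|d IH] hd; first by rewrite !addn0.
rewrite !addnS aboveS staircase_one ?addn1 ?ltnS; [|lia..].
by apply: IH; lia.
Qed.

(** The heights telescope: column 0 contributes [height 0], and the last height is [m]. *)
Lemma weight_columns : K * n.-1 + m + n.-1 <= \sum_(0 <= j < n) above m j.
Proof.
suff H j : j < n -> K * j + height j + j <= \sum_(0 <= j' < j.+1) above m j'.
  by have := H n.-1; rewrite height_last prednK // => ->.
elim: j => [|j IH] jn.
  rewrite big_nat1 muln0 add0n addn0; apply: leq_trans (above_le _ _ 0 (height_le 0)).
  elim: {-2}(height 0) (leqnn (height 0)) => // i IH hi.
  by rewrite aboveS staircase_one ?addn1 ?ltnS ?IH // ltnW.
rewrite big_nat_recr //=; have := IH (ltnW jn).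
by have := @column_weight j.+1 jn; rewrite /= mulnS; lia.
Qed.

End Saturated.

(** * Reflection in the antidiagonal *)

(** The reflection reverses the order of a chain. Relating [A] and [B] entrywise lets the lemma
    serve in both directions. *)
Lemma chain_antitranspose A B m n r1 r2 c1 c2 t :
  (forall i j, i < m -> j < n -> B (n.-1 - j) (m.-1 - i) = A i j) ->
  r2 <= m -> c2 <= n ->
  chain A r1 r2 c1 c2 t -> chain B (n - c2) (n - c1) (m - r2) (m - r1) t.
Proof.
move=> AB r2m c2n [r [c [S I]]].
exists (fun a => n.-1 - c (t.-1 - a)), (fun a => m.-1 - r (t.-1 - a)).
split=> a ha.
  have [] := S (t.-1 - a.+1); first lia.
  have -> : (t.-1 - a.+1).+1 = t.-1 - a by lia.
  by have [|_ ? ?] := I (t.-1 - a); first lia; split; lia.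
have [|? ? ?] := I (t.-1 - a); first lia.
by rewrite AB; [split=> //; lia|lia..].
Qed.

Definition antitranspose (m n : nat) (A : nat -> nat -> bool) i j :=
  A (m.-1 - j) (n.-1 - i).

Section Antitranspose.

Variables (A : nat -> nat -> bool) (K m n : nat).
Let B := antitranspose m n A.

Let AB i j : i < m -> j < n -> B (n.-1 - j) (m.-1 - i) = A i j.
Proof. by move=> im jn; rewrite /B /antitranspose; congr A; lia. Qed.

Lemma avoiding_antitranspose : avoiding A K m n -> avoiding B K n m.
Proof.
move=> avA r c rn cm Brc ch.
apply: (avA (m.-1 - c) (n.-1 - r) _ _ Brc); try lia.
have := @chain_antitranspose B A n m _ _ _ _ _ _ _ _ ch.
move=> H; apply: chain_sub (H _ _ _) => //; lia.
Qed.

Lemma completing_antitranspose : completing A K m n -> completing B K n m.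
Proof.
move=> coA i j im jn Bij.
have [||ch|[r [c [s [/andP[ir rm] cj Arc sK [ch1 ch2]]]]]] :=
  coA (m.-1 - j) (n.-1 - i) _ _ Bij; try lia.
  left; have := @chain_antitranspose A B m n _ _ _ _ _ AB _ _ ch.
  by move=> H; apply: chain_sub (H _ _); lia.
(* The two chains trade places, so [s] becomes [K - s]. *)
right; exists (n.-1 - c), (m.-1 - r), (K - s); split; try lia.
  by rewrite AB //; lia.
split.
  have := @chain_antitranspose A B m n _ _ _ _ _ AB _ _ ch2.
  by move=> H; apply: chain_sub (H _ _); lia.
have := @chain_antitranspose A B m n _ _ _ _ _ AB _ _ ch1.
by move=> H; apply: chain_sub (H _ _); lia.
Qed.

End Antitranspose.

(** * From matrices and [J k] to arrays and chains *)

Definition entry {m n} (M : 'M[bool]_(m, n)) (i j : nat) : bool :=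
  if (insub i, insub j) is (Some a, Some b) then M a b else false.

Lemma entry_ord {m n} (M : 'M[bool]_(m, n)) (i : 'I_m) (j : 'I_n) :
  entry M i j = M i j.
Proof. by rewrite /entry !valK. Qed.

Lemma containsJ K m n (M : 'M[bool]_(m, n)) :
  reflect (exists (r : 'I_m) (c : 'I_n),
             M r c /\ chain (entry M) 0 r c.+1 n K.+1)
          (contains (J K.+2) M).
Proof.
apply: (iffP existsP) => [[r /existsP[c /and3P[ir ic H]]]|].
  have incr q (f : {ffun 'I_K.+2 -> 'I_q}) a b :
      increasing f -> a < b < K.+2 -> f (inord a) < f (inord b).
    move=> /forallP/(_ (inord a))/forallP/(_ (inord b))/implyP h ab.
    by apply: h; rewrite !inordK; lia.
  have Jm a b : a < K.+2 -> b < K.+2 ->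
      (b == a.+1) || (a.+1 == K.+2) && (b == 0) -> M (r (inord a)) (c (inord b)).
    move=> ha hb; move/forallP/(_ (inord a))/forallP/(_ (inord b))/implyP: H.
    by rewrite mxE !inordK.
  exists (r (inord K.+1)), (c (inord 0)); split; first by apply: Jm; rewrite ?eqxx ?orbT.
  exists (fun a => val (r (inord a))), (fun a => val (c (inord a.+1))).
  split=> a ha.
    by split; apply: incr => //; lia.
  rewrite /= entry_ord; split; first by apply: Jm; rewrite ?eqxx //; lia.
    by apply: incr => //; lia.
  by rewrite ltn_ord andbT; apply: incr => //; lia.
case=> r0 [c0 [Mrc [r [c [S I]]]]].
have Ir a : a < K.+1 -> r a < m.
  by move=> /I[_ ? _]; have := ltn_ord r0; lia.
have Ic a : a < K.+1 -> c a < n by move=> /I[_ _]; lia.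
(* The corner takes the last row and the first column, which shifts the chain's column indices by
   one. All values are in range, so the defaults of [insubd] never occur. *)
pose R (a : 'I_K.+2) : 'I_m := if a < K.+1 then insubd r0 (r a) else r0.
pose C (a : 'I_K.+2) : 'I_n := if 0 < a then insubd c0 (c a.-1) else c0.
have RE (a : 'I_K.+2) : a < K.+1 -> R a = r a :> nat.
  by move=> h; rewrite /R h val_insubd Ir.
have CE (a : 'I_K.+2) : 0 < a -> C a = c a.-1 :> nat.
  by move=> h; rewrite /C h val_insubd Ic //; have := ltn_ord a; lia.
exists (finfun R); apply/existsP; exists (finfun C); apply/and3P; split.
- apply/forallP => a; apply/forallP => b; apply/implyP => ab; rewrite !ffunE.
  have hb := ltn_ord b; rewrite (RE a); last lia.
  have [bK|bK] := ltnP b K.+1.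
    by rewrite (RE b) //; have [|] := @step_lt r c K.+1 S a b; lia.
  by rewrite /R (ltnNge b) bK /=; have [|] := I a; lia.
- apply/forallP => a; apply/forallP => b; apply/implyP => ab; rewrite !ffunE.
  have hb := ltn_ord b; rewrite (CE b); last lia.
  have [a0|a0] := posnP a.
    by rewrite /C a0 /=; have [|] := I b.-1; lia.
  by rewrite (CE a) //; have [|] := @step_lt r c K.+1 S a.-1 b.-1; lia.
- apply/forallP => a; apply/forallP => b; rewrite mxE !ffunE; apply/implyP.
  case/predU1P=> [e|/andP[/eqP e /eqP b0]].
    have aK : a < K.+1 by have := ltn_ord b; lia.
    have [+ _ _] := I a aK; rewrite -entry_ord RE // CE ?e //.
  by rewrite /R /C b0 -ltnS e ltnn.
Qed.

Section SaturatingJ.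

Variables (K m n : nat) (M : 'M[bool]_(m, n)).
Hypothesis satM : saturating (J K.+2) M.

Lemma saturating_avoiding : avoiding (entry M) K m n.
Proof.
case/andP: satM => avM _ r c rm cn.
rewrite (entry_ord M (Ordinal rm) (Ordinal cn)) => Mrc ch.
by case/containsJ: avM; exists (Ordinal rm), (Ordinal cn).
Qed.

(** The added one is either the corner of the new pattern or entry [s] of its chain; otherwise [M]
    itself would contain the pattern. *)
Lemma saturating_completing : completing (entry M) K m n.
Proof.
case/andP: (satM) => _ + i0 j0 im jn.
have {im} [i ->] : exists i : 'I_m, i0 = i by exists (Ordinal im).
have {jn} [j ->] : exists j : 'I_n, j0 = j by exists (Ordinal jn).
move/forallP/(_ i)/forallP/(_ j)/implyP; rewrite entry_ord => H /H{H}.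
case/containsJ => r0 [c0 [Nrc [r [c [S I]]]]].
have I' a : a < K.+1 -> (r a, c a) != (val i, val j) ->
    [/\ entry M (r a) (c a), 0 <= r a < r0 & c0.+1 <= c a < n].
  move=> /I[Na ra ca] ne; split=> //.
  have rm : r a < m by have := ltn_ord r0; lia.
  have cn : c a < n by lia.
  move: Na ne; rewrite (entry_ord _ (Ordinal rm) (Ordinal cn)) mxE.
  rewrite (entry_ord M (Ordinal rm) (Ordinal cn)).
  move=> /orP[//|/andP[/eqP e1 /eqP e2]].
  by rewrite -e1 -e2 eqxx.
move: Nrc; rewrite mxE => /orP[Mrc|/andP[/eqP er /eqP ec]]; last first.
  left; rewrite -er -ec; exists r, c; split=> // a ha; apply: I' => //.
  apply/negP => /eqP[_ e]; have [_ _] := I a ha.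
  by rewrite ec e; lia.
right; have [/existsP[s /eqP[es1 es2]]|] :=
    boolP [exists s : 'I_K.+1, (r s, c s) == (val i, val j)]; last first.
  rewrite negb_exists => /forallP H; case/andP: satM => /containsJ[].
  exists r0, c0; split=> //; exists r, c; split=> // a ha; apply: I' => //.
  exact: (H (Ordinal ha)).
have sK := ltn_ord s; have [_ h1 h2] := I s sK.
exists r0, c0, s; split; first by have := ltn_ord r0; move: h1; rewrite es1 /=; lia.
- by move: h2; rewrite es2 /=; lia.
- by rewrite entry_ord.
- by lia.
rewrite -subSS; apply: (chain_split _ _ _ _ _ _ _ s _ r c) => // a ha nas.
apply: I' => //; apply/negP => /eqP[e1 e2].
case: (ltngtP a s) nas => // sa _.
  by have [|] := @step_lt r c K.+1 S a s; lia.
by have [|] := @step_lt r c K.+1 S s a; lia.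
Qed.

Lemma weight_above : weight M = \sum_(0 <= j < n) above (entry M) m j.
Proof.
rewrite /weight exchange_big big_mkord; apply: eq_bigr => j _.
by rewrite /above big_mkord; apply: eq_bigr => i _; rewrite entry_ord.
Qed.

Lemma weight_antitranspose :
  weight M = \sum_(0 <= j < m) above (antitranspose m n (entry M)) n j.
Proof.
rewrite /weight big_mkord (reindex_inj rev_ord_inj); apply: eq_bigr => i _.
rewrite /above big_mkord (reindex_inj rev_ord_inj); apply: eq_bigr => j _.
by rewrite -entry_ord /antitranspose /=; congr (nat_of_bool (entry M _ _)); lia.
Qed.

(** Counting by columns gives the factor [n.-1], the reflected array gives [m.-1]; the larger one is
    kept. *)
Lemma weight_saturatingJ : K.+1 < m -> K.+1 < n ->
  K * (maxn m n).-1 + m + n.-1 <= weight M.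
Proof.
move=> Km Kn; have avM := saturating_avoiding; have coM := saturating_completing.
have h1 : K * n.-1 + m + n.-1 <= weight M.
  by rewrite weight_above; apply: weight_columns => //; lia.
have h2 : K * m.-1 + n + m.-1 <= weight M.
  rewrite weight_antitranspose; apply: weight_columns; try lia.
    exact: avoiding_antitranspose.
  exact: completing_antitranspose.
by case: (leqP m n) => _; lia.
Qed.

End SaturatingJ.

(** * The bound over the rationals *)

Local Open Scope ring_scope.

Theorem theorem6 (k m n : nat) (hk : (2 <= k)%N) (hm : (k <= m)%N)
    (hn : (k <= n)%N) :
  (k%:R - 2) * (maxn m n)%:R + m%:R + n%:R - 1
    - (k%:R - 2) * (k%:R - 1) / 2 <= (sat (J k) m n)%:R :> rat.
Proof.
case: k hk hm hn => [|[|K]] // _ Km Kn.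
have [|[M satM <-] _] := @satP K.+2 K.+2 m n (J K.+2) ord_max ord0.
  by rewrite mxE /= !eqxx.
have wM := weight_saturatingJ _ _ _ _ satM Km Kn.
set X := maxn m n in wM *.
have X0 : (0 < X)%N by rewrite /X; lia.
have h1 : (K * X + m + n <= weight M + K + 1)%N.
  by move: wM X0; case: X => // X; rewrite /= mulnS; lia.
(* The weight bound loses [K] against [K * X + m + n - 1], while the claim allows a loss of
   [K * (K + 1) / 2]. *)
have h2 : (2 * K <= K * K + K)%N by case: (K) => // K'; nia.
have -> : K.+2%:R = K%:R + 2 :> rat by rewrite -addn2 GRing.natrD.
move: h1 h2; rewrite -!(Num.Theory.ler_nat rat) !GRing.natrD !GRing.natrM => h1 h2.
lra.
Qed.
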